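(* Let $N=\{1,\dots,n\}$ and let $\mathbf{c}=(c_{ij})$ be a real $n\times n$ cost matrix. Consider the link bias game on $N$ in which Player $i$ has payoff $Y_i(\mathbf{x})=-\sum_{j}c_{ij}x_{ij}$ on each graph $\mathbf{x}$, with value function $v(\mathbf{x})=\sum_i Y_i(\mathbf{x})$. For $i\neq j$ let $s_{ij}=1$ if $c_{ij}<0$ and $s_{ij}=0$ if $c_{ij}\ge 0$. If $\mathbf{x}$ (with $x_{ii}=0$ for all $i$) is an optimal solution of the integer program $$\begin{aligned}\max\;\;&\sum_i\sum_j c_{ij}x_{ij}\\ \text{s.t.}\;\;& x_{ij}=x_{ji} && \forall\, i\neq j\\ & s_{ij}+s_{ji}-1\le x_{ij} && \forall\, i\neq j\\ & x_{ij}\le s_{ij} && \forall\, i\neq j\\ & x_{ij}\le s_{ji} && \forall\, i\neq j\\ & x_{ij}\in\{0,1\} && \forall\, i\neq j,\end{aligned}$$ then $\mathbf{x}$ is a stable graph, and its net payoff $\sum_i Y_i(\mathbf{x})$ is minimum among the net payoffs of all stable graphs.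
   Context: A graph on $N$ is a simple undirected graph, identified with its symmetric adjacency matrix $\mathbf{x}=(x_{ij})\in\{0,1\}^{n\times n}$ with $x_{ii}=0$ for all $i$. In the link bias game with cost matrix $\mathbf{c}$, Player $i$ has cost $f_i(\mathbf{x})=\sum_j c_{ij}x_{ij}$ and payoff $Y_i=-f_i$. Links require the consent of both players, and a link is established if and only if both players strictly benefit (link parsimony). Accordingly, a graph $\mathbf{x}$ is called (pairwise) stable in the link bias game if for all $i\neq j$: (1) if $x_{ij}=1$, then $c_{ij}<0$ and $c_{ji}<0$; and (2) if $x_{ij}=0$ and $c_{ij}<0$, then $c_{ji}\ge 0$. The net payoff of $\mathbf{x}$ is $\sum_i Y_i(\mathbf{x})$. *)

(* Defs.v *)
From mathcomp Require Import all_boot all_order all_algebra.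
From mathcomp Require Import reals.

Set Implicit Arguments.
Unset Strict Implicit.
Unset Printing Implicit Defensive.

Import Order.TTheory GRing.Theory Num.Theory.
Local Open Scope ring_scope.

Section LinkBias.
Variables (R : realType) (n : nat).
Implicit Types c x y : 'M[R]_n.

(* Simple undirected graphs are adjacency matrices with 0/1 entries, the
   entries being taken in R so that they can be multiplied by costs. *)
Definition is_graph x : Prop :=
  [/\ forall i j, x i j = 0 \/ x i j = 1,
      forall i j, x i j = x j i
    & forall i, x i i = 0].

Definition cost c (i : 'I_n) x : R := \sum_(j < n) c i j * x i j.

Definition payoff c (i : 'I_n) x : R := - cost c i x.

Definition net_payoff c x : R := \sum_(i < n) payoff c i x.

Definition stable c x : Prop :=
  is_graph x /\
  forall i j : 'I_n, i != j ->
    (x i j = 1 -> c i j < 0 /\ c j i < 0) /\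
    (x i j = 0 -> c i j < 0 -> 0 <= c j i).

(* Only the off-diagonal values matter. *)
Definition benefit c (i j : 'I_n) : R := if c i j < 0 then 1 else 0.

(* The diagonal entries are not decision variables of the program: they are
   fixed to 0 although the objective sums over all pairs (i, j). *)
Definition feasible c x : Prop :=
  (forall i, x i i = 0) /\
  forall i j : 'I_n, i != j ->
    [/\ x i j = x j i,
        benefit c i j + benefit c j i - 1 <= x i j,
        x i j <= benefit c i j,
        x i j <= benefit c j i
      & x i j = 0 \/ x i j = 1].

Definition objective c x : R := \sum_(i < n) \sum_(j < n) c i j * x i j.

Definition optimal c x : Prop :=
  feasible c x /\ forall y, feasible c y -> objective c y <= objective c x.

End LinkBias.

(* Main.v *)
Require Import Defs.
From mathcomp Require Import all_boot all_order all_algebra.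
From mathcomp Require Import reals lra.

Import Order.TTheory GRing.Theory Num.Theory.
Local Open Scope ring_scope.

(** For 0/1 entries, the linear constraints linearize the product $x_{ij}=s_{ij}s_{ji}$: a link
    exists iff both costs are negative, which is stability. So feasible points and stable graphs
    coincide ([feasible_stable]), and since net payoff is minus the objective ([net_payoffE]),
    maximizing one minimizes the other. *)

Lemma net_payoffE (R : realType) (n : nat) (c x : 'M[R]_n) :
  net_payoff c x = - objective c x.
Proof. by rewrite /net_payoff /payoff sumrN. Qed.

Lemma feasible_stable (R : realType) (n : nat) (c x : 'M[R]_n) :
  feasible c x <-> stable c x.
Proof.
split=> [[x0 xF]|[[x01 xC x0] xS]].
- split.
    (* The constraints cover only $i\neq j$; [x0] settles the diagonal. *)
    by split=> // i j; have [<-|/xF[]//] := eqVneq i j; first left.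
  move=> i j /xF[_ + + + _]; rewrite /benefit.
  by case: (ltrP (c i j) 0) => hij; case: (ltrP (c j i) 0) => hji lo up1 up2;
    split=> xij //; exfalso; lra.
- split=> // i j ij; have [S1 S0] := xS i j ij.
  rewrite /benefit; split=> //; have [xij|xij] := x01 i j; rewrite xij.
  (* Without a link, at most one of the two benefits is 1, so the lower bound is at most 0. *)
  + have := S0 xij; case: (ltrP (c i j) 0) => [_ /(_ isT) hji|_ _];
      by case: (ltrP (c j i) 0) => ?; lra.
  + by have [-> ->] := S1 xij; lra.
  + by case: ifP.
  + by have [-> _] := S1 xij.
  + by case: ifP.
  + by have [_ ->] := S1 xij.
Qed.

Theorem proposition6p1 (R : realType) (n : nat) (c x : 'M[R]_n) :
  optimal c x ->
  stable c x /\ (forall y : 'M[R]_n, stable c y -> net_payoff c x <= net_payoff c y).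
Proof.
move=> [xF xmax]; split; first exact/feasible_stable.
by move=> y /feasible_stable yF; rewrite !net_payoffE lerN2 xmax.
Qed.
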